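(* Let $u\in\mathbb U$, let $\mathcal V$ be a family of stencils on $X$, and let $x\in X$. Then $$\mathcal D_{\mathcal V}u(x)>0\quad\Longleftrightarrow\quad\forall e\in\mathcal V(x),\ \Delta_eu(x)>0.$$
   Context: $\Omega\subset\mathbb R^2$ is a fixed convex open bounded set, $X:=\Omega\cap\mathbb Z^2$, and $\mathbb U$ is the set of all maps $u:X\cup\partial\Omega\to\mathbb R$. Second order differences: for $e\in\mathbb Z^2\setminus\{0\}$, $u\in\mathbb U$, $x\in X$, let $h^{\pm}:=1$ if $x\pm e\in\Omega$, and otherwise let $h^\pm$ be the unique element of $]0,1]$ with $x\pm h^\pm e\in\partial\Omega$; set $$\Delta_e u(x):=\frac{2}{h^++h^-}\left(\frac{u(x+h^+e)-u(x)}{h^+}+\frac{u(x-h^-e)-u(x)}{h^-}\right),\qquad \Delta_e^+u(x):=\max\{0,\Delta_e u(x)\}.$$ A superbase of $\mathbb Z^2$ is a triplet $(e,f,g)\in(\mathbb Z^2)^3$ with $e+f+g=0$ and $|\det(f,g)|=1$. For $a,b,c\ge0$, $h(a,b,c):=bc$ if $a\ge b+c$, and likewise permuting $a,b,c$; otherwise $h(a,b,c):=\frac12(ab+bc+ca)-\frac14(a^2+b^2+c^2)$. Decomposition: $e=f\oplus g$ means that $e=f+g$ with $f,g\in\mathbb Z^2$, $\det(f,g)=1$, $\langle f,g\rangle\ge0$. (Such a decomposition exists, and is then unique, exactly when $e=(a,b)\in\mathbb Z^2$ with $\gcd(a,b)=1$ and $ab\ne0$.) Graph $\mathbb T$: vertices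 $\{e\in\mathbb Z^2;\gcd(e)=1\}$ (gcd of the two coordinates); edges $e\to f\oplus e$ and $e\to e\oplus g$ for each $e=f\oplus g$. Any subset of $\mathbb T$ is regarded as a subgraph, with all edges of $\mathbb T$ having both endpoints in it. $V_8:=\{-1,0,1\}^2\setminus\{(0,0)\}$. For $x\in X$, $\mathcal V_\Omega(x):=\{e=f\oplus g;\ x\pm e,\,x\pm f,\,x\pm g\in\Omega\}$, where ''$x\pm e\in\Omega$'' means $x+e\in\Omega$ and $x-e\in\Omega$. A stencil is a finite subset of $\mathbb Z^2\setminus\{0\}$ symmetric with respect to the origin. A family of stencils $\mathcal V$ is the data, for each $x\in X$, of a stencil $\mathcal V(x)$ with $V_8\subset\mathcal V(x)\subset\mathbb T$ and such that: (Hierarchy) $V_8$ has an element in each connected component of $\mathcal V(x)$; (Reachability) $\mathcal V(x)$ contains each $e\in\mathbb T\setminus\mathcal V_\Omega(x)$ such that $x\pm e\in\Omega$. For a family of stencils $\mathcal V$, $$\mathcal D_{\mathcal V}u(x):=\min\{h(\Delta^+_eu(x),\Delta^+_fu(x),\Delta^+_gu(x));\ (e,f,g)\in\mathcal V(x)^3\text{ a superbase of }\mathbb Z^2\}.$$ *)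

(* Defs.v *)
From HB Require Import structures.
From mathcomp Require Export all_boot all_order all_algebra finmap.
From mathcomp Require Export all_classical all_reals all_analysis.

Set Implicit Arguments.
Unset Strict Implicit.
Unset Printing Implicit Defensive.

Export Order.TTheory GRing.Theory Num.Theory.
Export numFieldNormedType.Exports.

Local Open Scope classical_set_scope.
Local Open Scope ring_scope.

Notation Z2 := (int * int)%type.

Section Lattice.

Definition det2 (f g : Z2) : int := f.1 * g.2 - f.2 * g.1.

Definition dot2 (f g : Z2) : int := f.1 * g.1 + f.2 * g.2.

Definition superbase (e f g : Z2) : Prop :=
  e + f + g = 0 /\ `|det2 f g| = 1.

(* e = f \oplus g *)
Definition is_oplus (e f g : Z2) : Prop :=
  [/\ e = f + g, det2 f g = 1 & 0 <= dot2 f g].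

Definition T_vertex (e : Z2) : Prop := gcdz e.1 e.2 = 1.

(* the edges of T leaving e = f \oplus g go to f \oplus e and to e \oplus g *)
Definition T_edge (e e' : Z2) : Prop :=
  exists f g, is_oplus e f g /\ (is_oplus e' f e \/ is_oplus e' e g).

Definition V8 : {fset Z2} :=
  let s : seq int := [:: -1; 0; 1] in
  ([fset e : Z2 in [seq (a, b) | a <- s, b <- s]] `\ (0, 0))%fset.

(* The orientation of the edges is ignored: the connected components of a
   subgraph V of T are the classes of connect (T_adj V) *)
Definition T_adj (V : {fset Z2}) : rel V :=
  fun e e' => `[< T_edge (val e) (val e') \/ T_edge (val e') (val e) >].

Definition hierarchy (V : {fset Z2}) : Prop :=
  forall e : V, exists2 e0 : V, val e0 \in V8 & connect (@T_adj V) e e0.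

Definition stencil (V : {fset Z2}) : Prop :=
  0 \notin V /\ (forall e, e \in V -> - e \in V).

End Lattice.

Section Domain.
Variable R : realType.
Implicit Types (Omega : set (R * R)) (x e : Z2).

Definition emb e : R * R := (e.1%:~R, e.2%:~R).

Definition bdry (A : set (R * R)) : set (R * R) := closure A `\` interior A.

Definition grid Omega : set Z2 := [set x | Omega (emb x)].

Definition gridfun Omega : Type :=
  set_type (emb @` grid Omega `|` bdry Omega) -> R.

(* The default value 0 is irrelevant: gfval u is only used at points of
   X `|` bdry Omega. *)
Definition gfval Omega (u : gridfun Omega) (p : R * R) : R :=
  oapp u 0 (insub p).

Definition pm_in Omega x e : Prop := Omega (emb (x + e)) /\ Omega (emb (x - e)).

(* h^+ in the direction e; h^- is hstep Omega x (- e) *)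
Definition hstep Omega x e : R :=
  if `[< Omega (emb (x + e)) >] then 1
  else get [set h : R | 0 < h <= 1 /\ bdry Omega (emb x + h *: emb e)].

Definition Delta Omega (u : gridfun Omega) e x : R :=
  let hp := hstep Omega x e in
  let hm := hstep Omega x (- e) in
  2 / (hp + hm) *
  ((gfval u (emb x + hp *: emb e) - gfval u (emb x)) / hp +
   (gfval u (emb x - hm *: emb e) - gfval u (emb x)) / hm).

Definition Deltap Omega (u : gridfun Omega) e x : R := Num.max 0 (Delta u e x).

Definition hfun (a b c : R) : R :=
  if b + c <= a then b * c
  else if c + a <= b then c * a
  else if a + b <= c then a * b
  else (a * b + b * c + c * a) / 2 - (a ^+ 2 + b ^+ 2 + c ^+ 2) / 4.

Definition VOmega Omega x : set Z2 :=
  [set e | exists f g,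
    [/\ is_oplus e f g, pm_in Omega x e, pm_in Omega x f & pm_in Omega x g]].

Definition reachability Omega x (V : {fset Z2}) : Prop :=
  forall e, T_vertex e -> ~ VOmega Omega x e -> pm_in Omega x e -> e \in V.

(* The values of V outside the grid are irrelevant. *)
Definition stencil_family Omega (V : Z2 -> {fset Z2}) : Prop :=
  forall x, grid Omega x ->
    [/\ stencil (V x),
        {subset V8 <= V x} /\ (forall e, e \in V x -> T_vertex e),
        hierarchy (V x)
      & reachability Omega x (V x)].

(* the minimum of A, if it exists *)
Definition set_min (A : set R) : R := get [set m | A m /\ lbound A m].

Definition DV Omega (V : Z2 -> {fset Z2}) (u : gridfun Omega) x : R :=
  set_min [set r | exists e f g,
    [/\ [/\ e \in V x, f \in V x & g \in V x], superbase e f g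
      & r = hfun (Deltap u e x) (Deltap u f x) (Deltap u g x)]].

End Domain.

(* Main.v *)
From mathcomp Require Import zify ring lra.
Require Import Defs.

(** The function [hfun] is positive exactly when its three arguments are
    ([hfun_gt0]), and the set minimized in [DV] is finite and nonempty, so that
    [DV V u x > 0] means that [Delta u e x > 0] whenever [e] belongs to a
    superbase contained in [V x].  It remains to see that every element of
    [V x] belongs to such a superbase, which is a consequence of the hierarchy
    property.

    If [e = f (+) g] then [(e, - f, - g)] is a superbase, hence it suffices to
    find [f] and [g] in [V x], which is symmetric.  Apart from the isolated
    coordinate vectors, the graph on primitive vectors consists of four copies
    of the Stern-Brocot tree, rooted at the vectors [(+-1, +-1)].  In there, [f]
    and [g] are either ancestors of [e] or coordinate vectors; and a path from
    [e] to [V8] has to go through all the ancestors of [e].  To avoid describing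
    the trees, consider the elements of [V x] all of whose iterated summands are
    in [V x], until [V8] is reached ([ancestry]).  Since decompositions are
    unique ([oplus_uniq]), the summands of such a vector have the same property,
    and from there one sees that it propagates along the edges of [V x], upwards
    as well as downwards ([ancestry_edge]).  It holds on [V8], and thus on each
    component of [V x]. *)

Set Implicit Arguments.
Unset Strict Implicit.

Local Open Scope classical_set_scope.
Local Open Scope ring_scope.

(** * Decompositions of lattice vectors *)

Lemma mem_V8 (e : Z2) : (e \in V8) = (0 < dot2 e e <= 2).
Proof.
rewrite !inE /dot2; case: e => a b /=.
rewrite !xpair_eqE.
by apply/idP/idP; lia || nia.
Qed.

Lemma dot2_gt0_det (f g : Z2) : det2 f g = 1 -> 0 < dot2 f f /\ 0 < dot2 g g.
Proof. by rewrite /det2 /dot2; case: f g => [a b] [c d] /=; split; nia. Qed.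

(** Two decompositions [f (+) g] and [f' (+) g'] of [e] differ by a multiple [t]
    of [e].  As [dot2 (f + t e) (g - t e)] is at most [- 2 |f|^2] when [t > 0],
    and at most [- 2 |g|^2] when [t < 0], only [t = 0] is possible. *)
Lemma oplus_uniq (e f g f' g' : Z2) :
  is_oplus e f g -> is_oplus e f' g' -> f = f' /\ g = g'.
Proof.
move=> [-> dfg pfg] [efg dfg' pfg'].
have [F0 G0] := dot2_gt0_det dfg.
pose t := det2 f' g - 1.
have f'E : f' = f + (t * (f + g).1, t * (f + g).2).
  (* t + 1 and t are the coordinates of f' in the basis (f, g); those two
     coordinates differ by det2 f' e = 1 *)
  have tE : t = det2 f f'.
    have : det2 f' (f + g) = 1.
      by rewrite efg -dfg' /det2 /=; ring.
    by rewrite /t /det2 /= => d1; lia.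
  have crd1 : det2 f g * f'.1 = det2 f' g * f.1 + det2 f f' * g.1.
    by rewrite /det2; ring.
  have crd2 : det2 f g * f'.2 = det2 f' g * f.2 + det2 f f' * g.2.
    by rewrite /det2; ring.
  move: crd1 crd2; rewrite dfg !mul1r -tE -[det2 f' g](subrK 1) -/t => e1 e2.
  by rewrite [LHS]surjective_pairing e1 e2; congr pair => /=; ring.
have g'E : g' = g - (t * (f + g).1, t * (f + g).2).
  by rewrite -[LHS](addKr f') -efg {1}f'E opprD -addrA addrCA addKr addrC.
have d'E : dot2 f' g' = dot2 f g + t * (dot2 g g - dot2 f f)
                        - t ^+ 2 * (dot2 f f + dot2 g g + 2 * dot2 f g).
  rewrite f'E g'E /dot2 /=; ring.
have t0 : t = 0.
  move: pfg pfg' F0 G0; rewrite d'E.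
  move: (dot2 f f) (dot2 g g) (dot2 f g) => F G d d0 d'0 F0 G0.
  have S0 : 0 <= F + G + 2 * d by lia.
  have [t0|t0|//] := ltgtP t 0.
  - have : 0 <= t * (t + 1) * (F + G + 2 * d) by rewrite mulr_ge0 //; nia.
    have : 0 <= (- t - 1) * d by rewrite mulr_ge0 //; lia.
    have : 0 < - t * G by rewrite mulr_gt0 // oppr_gt0.
    by lia.
  - have : 0 <= t * (t - 1) * (F + G + 2 * d) by rewrite mulr_ge0 //; nia.
    have : 0 <= (t - 1) * d by rewrite mulr_ge0 //; lia.
    have : 0 < t * F by rewrite mulr_gt0.
    by lia.
by rewrite f'E g'E t0 !mul0r addr0 subr0.
Qed.

(** As [|e|^2 >= |f|^2 + |g|^2] and [V8] is the punctured disk [|e|^2 <= 2], the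
    summands satisfy [|f|^2 = |g|^2 = 1]. *)
Lemma oplus_V8 (e f g : Z2) :
  is_oplus e f g -> e \in V8 -> f \in V8 /\ g \in V8.
Proof.
move=> [-> dfg pfg]; have [F0 G0] := dot2_gt0_det dfg.
have -> : (f + g \in V8) = (0 < dot2 f f + dot2 g g + 2 * dot2 f g <= 2).
  rewrite mem_V8 (_ : dot2 (f + g) (f + g) =
    dot2 f f + dot2 g g + 2 * dot2 f g) //.
  by rewrite /dot2 /=; ring.
by rewrite !mem_V8 F0 G0 /=; lia.
Qed.

(** A coordinate vector is completed by its rotation by a quarter turn, and
    [(a, b)] with [a], [b] both nonzero by the opposites of its components. *)
Lemma V8_superbase (e : Z2) : e \in V8 ->
  exists f g, [/\ f \in V8, g \in V8 & superbase e f g].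
Proof.
rewrite mem_V8 /dot2; case: e => a b /= eV8.
have sq1 (c : int) : 0 < c * c <= 2 -> c = 1 \/ c = -1.
  move=> c2; have [c0|c0|c0] := ltgtP c 0; last by move: c2; rewrite c0.
    by right; nia.
  by left; nia.
have [ab0|] := eqVneq (a * b) 0.
  have ab1 : a * a + b * b = 1.
    move/eqP: ab0; rewrite mulf_eq0 => /orP[] /eqP c0; move: eV8;
      rewrite c0 mul0r ?add0r ?addr0 => /sq1; lia.
  exists (- b, a), (b - a, - a - b).
  rewrite !mem_V8 /superbase /det2 /dot2 /=; split; [lia|lia|split; last lia].
  by congr pair => /=; ring.
rewrite mulf_eq0 negb_or => /andP[a0 b0].
have a1 : a = 1 \/ a = -1 by apply: sq1; nia.
have b1 : b = 1 \/ b = -1 by apply: sq1; nia.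
exists (- a, 0), (0, - b).
rewrite !mem_V8 /superbase /det2 /dot2 /=.
by case: a1 b1 {eV8 a0 b0} => -> [] ->.
Qed.

Lemma oplus_superbase (e f g : Z2) :
  is_oplus e f g -> superbase e (- f) (- g).
Proof.
case=> -> dfg _; split; first by rewrite -addrA -opprD subrr.
suff -> : det2 (- f) (- g) = det2 f g by rewrite dfg.
by rewrite /det2 /=; ring.
Qed.

(** * Hierarchy yields superbases *)

(** The iterated decomposition stops at [V8] because the coordinate vectors have
    no decomposition. *)
Inductive ancestry (V : {fset Z2}) (e : Z2) : Prop :=
| AncestryV8 of e \in V8
| AncestryOplus f g of
    e \in V & is_oplus e f g & ancestry V f & ancestry V g.

Lemma ancestry_mem (V : {fset Z2}) (e : Z2) :
  {subset V8 <= V} -> ancestry V e -> e \in V.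
Proof. by move=> V8V [/V8V|]. Qed.

Lemma ancestry_oplus (V : {fset Z2}) (e f g : Z2) :
  is_oplus e f g -> ancestry V e -> ancestry V f /\ ancestry V g.
Proof.
move=> efg [/(oplus_V8 efg)[fV8 gV8]|f' g' _ efg' Vf' Vg'].
  by split; apply: AncestryV8.
by have [-> ->] := oplus_uniq efg efg'.
Qed.

(** Downwards, the summands of [f (+) e] are [e] and a summand of [e];
    upwards, [e] is a summand of [f (+) e]. *)
Lemma ancestry_edge (V : {fset Z2}) (e e' : Z2) :
  e' \in V -> T_edge e e' -> ancestry V e <-> ancestry V e'.
Proof.
move=> Ve' [f [g [efg e'E]]]; split=> [Ve|Ve'_].
  have [Vf Vg] := ancestry_oplus efg Ve.
  by case: e'E => e'E; apply: AncestryOplus e'E _ _.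
by case: e'E => e'E; have [] := ancestry_oplus e'E Ve'_.
Qed.

Lemma hierarchy_ancestry (V : {fset Z2}) (e : Z2) :
  hierarchy V -> e \in V -> ancestry V e.
Proof.
move=> hV eV; have [e0 e0V8 /connectP[p]] := hV [` eV]%fset.
rewrite -[X in ancestry _ X]/(val [` eV]%fset).
elim: p [` eV]%fset => [e1 _ /= <-|e2 p IHp e1 /= /andP[/asboolP e12 pp] e0E].
  exact: AncestryV8.
have Ve2 := IHp e2 pp e0E.
case: e12 => e12; first exact: (ancestry_edge (fsvalP e2) e12).2 Ve2.
exact: (ancestry_edge (fsvalP e1) e12).1 Ve2.
Qed.

Lemma hierarchy_superbase (V : {fset Z2}) (e : Z2) :
  stencil V -> {subset V8 <= V} -> hierarchy V -> e \in V ->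
  exists f g, [/\ f \in V, g \in V & superbase e f g].
Proof.
move=> [_ VN] V8V hV eV; case: (hierarchy_ancestry hV eV).
  by move=> /V8_superbase[f [g [/V8V fV /V8V gV efg]]]; exists f, g.
move=> f g _ efg /(ancestry_mem V8V)/VN fV /(ancestry_mem V8V)/VN gV.
by exists (- f), (- g); split => //; apply: oplus_superbase.
Qed.

(** * Positivity of the minimum *)

(** If one argument is at least the sum of the others, [hfun] is the product of
    the others; otherwise the three strict triangle inequalities force all
    arguments, as well as the quadratic expression, to be positive. *)
Lemma hfun_gt0 (R : realType) (a b c : R) : 0 <= a -> 0 <= b -> 0 <= c ->
  (0 < hfun a b c) = [&& 0 < a, 0 < b & 0 < c].
Proof.
move=> a0 b0 c0; rewrite /hfun.
have pM (y z : R) : 0 <= y -> 0 <= z -> (0 < y * z) = (0 < y) && (0 < z).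
  by move=> y0 z0; rewrite !lt0r mulf_eq0 negb_or mulr_ge0 // y0 z0 !andbT.
case: ifPn => [bca|]; first by rewrite pM //; apply/idP/idP; lra.
rewrite -ltNge => abc; case: ifPn => [cab|].
  by rewrite pM //; apply/idP/idP; lra.
rewrite -ltNge => bca; case: ifPn => [abc'|].
  by rewrite pM //; apply/idP/idP; lra.
rewrite -ltNge => cab.
have [ap bp cp] : [/\ 0 < a, 0 < b & 0 < c] by split; lra.
rewrite ap bp cp /=.
(* a^2 < a (b + c), and similarly for b and c *)
have : 0 < a * (b + c - a) by rewrite mulr_gt0 // subr_gt0.
have : 0 < b * (c + a - b) by rewrite mulr_gt0 // subr_gt0.
have : 0 < c * (a + b - c) by rewrite mulr_gt0 // subr_gt0.
by nra.
Qed.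

Lemma set_minP (R : realType) (A : set R) : finite_set A -> A !=set0 ->
  A (set_min A) /\ lbound A (set_min A).
Proof.
move=> /finite_fsetP[X AX] [r0 Ar0].
apply: (@getPex _ [set m | A m /\ lbound A m]).
have r0X : r0 \in X by move: Ar0; rewrite AX.
have [m _ mP] := @arg_minP _ R X [` r0X]%fset xpredT val isT.
exists (val m); rewrite AX; split; first exact: valP.
by move=> r rX; exact: (mP [` rX]%fset isT).
Qed.

Lemma set_min_gt0 (R : realType) (A : set R) : finite_set A -> A !=set0 ->
  0 < set_min A <-> (forall r, A r -> 0 < r).
Proof.
move=> finA A0; have [Am mA] := set_minP finA A0.
split=> [m0 r /mA|]; [exact: lt_le_trans|exact].
Qed.

Lemma Deltap_gt0 (R : realType) (Omega : set (R * R)) (u : gridfun Omega)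
  (e x : Z2) : (0 < Deltap u e x) = (0 < Delta u e x).
Proof. by rewrite /Deltap lt_max ltxx. Qed.

(** The minimum is attained: it is over finitely many triplets, and [V8] contains
    a superbase. *)
Lemma DV_gt0 (R : realType) (Omega : set (R * R)) (u : gridfun Omega)
    (V : Z2 -> {fset Z2}) (x : Z2) : {subset V8 <= V x} ->
  0 < DV V u x <->
  (forall e f g, e \in V x -> f \in V x -> g \in V x -> superbase e f g ->
    [/\ 0 < Delta u e x, 0 < Delta u f x & 0 < Delta u g x]).
Proof.
move=> V8V.
have Dp0 e : 0 <= Deltap u e x by rewrite /Deltap le_max lexx.
rewrite /DV set_min_gt0; last 2 first.
- pose h (t : Z2 * Z2 * Z2) :=
    hfun (Deltap u t.1.1 x) (Deltap u t.1.2 x) (Deltap u t.2 x).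
  apply: (@sub_finite_set _ _
    (h @` ([set` V x] `*` [set` V x] `*` [set` V x]))).
    by move=> _ [e [f [g [[eV fV gV] _ ->]]]]; exists (e, f, g).
  by apply: finite_image; do 2 ?apply: finite_setX; exact: finite_fset.
- have e1V8 : (1, 0) \in V8 by rewrite mem_V8.
  have [f [g [/V8V fV /V8V gV efg]]] := V8_superbase e1V8.
  by eexists; exists (1, 0), f, g; split; first by split=> //; apply: V8V.
split=> [DV0 e f g eV fV gV efg|DV0 _ [e [f [g [[eV fV gV] efg ->]]]]].
  have := DV0 _ (ex_intro _ e (ex_intro _ f (ex_intro _ g
            (And3 (And3 eV fV gV) efg erefl)))).
  by rewrite hfun_gt0 // !Deltap_gt0 => /and3P.
by rewrite hfun_gt0 // !Deltap_gt0; apply/and3P; exact: DV0.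
Qed.

Unset Implicit Arguments.

Theorem proposition1p20 (R : realType) (Omega : set (R * R))
    (Omega_convex : convex_set Omega) (Omega_open : open Omega)
    (Omega_bounded : bounded_set Omega)
    (u : gridfun Omega) (V : Z2 -> {fset Z2}) (V_family : stencil_family Omega V)
    (x : Z2) (x_grid : grid Omega x) :
  0 < DV V u x <-> (forall e : Z2, e \in V x -> 0 < Delta u e x).
Proof.
have [sV [V8V _] hV _] := V_family x x_grid.
rewrite DV_gt0 //; split=> [D0 e eV|D0 e f g eV fV gV _].
  have [f [g [fV gV efg]]] := hierarchy_superbase sV V8V hV eV.
  by have [] := D0 e f g eV fV gV efg.
by split; apply: D0.
Qed.
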